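(* Let $R$ be a set and let $\phi$ be a dual tree generating set such that $\mathfrak{T}_\phi$ is a dissection compatible Hopf algebra. Then $\partial_\phi$ is a degree one differential operator on $\mathcal{P}^{(\star)}_\bullet(R)$; that is, the degree one derivation of $\mathcal{P}^{(\star)}_\bullet(R)$ determined by $$\partial_\phi(P)=\sum_{d\in D(P),\,|d|=1}\mathrm{sgn}_\phi(P,d)\,P^1_d\wedge P^2_d$$ on $R$-deco polygons $P$ satisfies $\partial_\phi\circ\partial_\phi=0$.
   Context: **Polygons.** An $R$-deco polygon of weight $n\ge1$ is a convex oriented $(n+1)$-gon with sides labelled by elements of $R$, a distinguished root side, and a marked first vertex which is an endpoint of the root side; written $x_1\ldots x_{n+1}$, listing labels along the orientation from the first vertex, $x_{n+1}$ being the root label. Side $j$ goes from vertex $j$ to vertex $j+1$ (mod $n+1$). $V_n(R)$ is the $\mathbb{Q}$-vector space with basis the polygons of weight $n$, $V_0(R)=\mathbb{Q}$, $V_\bullet(R)=\bigoplus_n V_n(R)$. $\mathcal{P}^{(\star)}_\bullet(R)$ is the exterior algebra over $\mathbb{Q}$ on the polygons, bigraded by weight and by exterior degree $(\star)$; the trivial polygon $1\in V_0(R)$ is identified with the unit. **Dissections.** An arrow of $P$ goes from vertex $i$ to side $j$, with $j\not\equiv i,i-1\pmod{n+1}$. A dissection is a set $d$ of pairwise non-intersecting arrows (they can be drawn with no common points except possibly a common starting vertex). $D(P)$ is the set of dissections including the empty one; $|d|$ is the number of arrows. **Trees.** A tree is a finite contractible graph with oriented edges (several roots allowed: a root has only outgoing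 edges, a leaf only incoming ones; a single vertex is both). $\mathcal{T}^\bullet(R)$ is the commutative $\mathbb{Q}$-algebra with basis the forests of trees with vertices labelled by $R$-deco polygons, with product disjoint union. It is a Hopf algebra with the multiplicative coproduct $\Delta(T)=\sum_cR(c)\otimes L(c)$ over admissible cuts $c$ of a tree $T$: the empty cut ($R=T$, $L=1$), the full cut ($R=1$, $L=T$), and the proper admissible cuts, i.e. non-empty sets $c$ of edges such that for each component $t$ of $T$ with $c$ removed, the edges of $c$ meeting $t$ either all flow into $t$ or all flow out of $t$; then $L(c)$ is the product of the components into which edges of $c$ flow, $R(c)$ the product of the others. **Dual tree generating sets.** A dual tree generating set $\phi$ assigns to every pair $(P,d)$, $P$ an $R$-deco polygon and $d\in D(P)$, an element $T_{\phi,d}(P)\in\mathcal{T}^\bullet(R)$ which is a tree multiplied by a sign $\mathrm{sgn}_\phi(P,d)=\mathrm{sgn}(T_{\phi,d}(P))\in\{\pm1\}$; $T_{\phi,\emptyset}(P)$ is the single vertex labelled $P$. $\mathfrak{T}_\phi\subset\mathcal{T}^\bullet(R)$ is the subalgebra generated by all $T_{\phi,d}(P)$. It is a dissection compatible Hopf algebra if: (1) $\mathfrak{T}_\phi$ is a sub-Hopf algebra of $\mathcal{T}^\bullet(R)$; (2) the edges of $T_{\phi,d}(P)$ correspond to the arrows in $d$; (3) if $d'\subset d\in D(P)$ corresponds to a subtree $T$ (taken without sign) of $T_{\phi,d}(P)$, there is an $R$-deco polygon $Q$ with $d'\in D(Q)$ and $\mathrm{sgn}(T_{\phi,d'}(Q))\,T=T_{\phi,d'}(Q)$;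 (4) for such $d'\subset d$, the tree of $T_{\phi,d\setminus d'}(P)$ is formed by replacing the subtree $T$ in $T_{\phi,d}(P)$ by a single vertex labelled $Q$; (5) for such $d'\subset d$, $\mathrm{sgn}(T_{\phi,d}(P))=\mathrm{sgn}(T_{\phi,d'}(Q))\,\mathrm{sgn}(T_{\phi,d\setminus d'}(P))$. Convention on arrows: if $T_{\phi,d}(P)$ has vertex labels $P^1_d,\dots,P^{|d|+1}_d$, then contracting the arrows of $d$ identifies dissections $d'\in D(P)$ with $d\subseteq d'$ bijectively with tuples $(d_j)_j$, $d_j\in D(P^j_d)$, via $d'=d\cup\bigcup_jd_j$; the edges $d_j$ form the component of $T_{\phi,d'}(P)$ (with edges $d$ removed) that contracts to the vertex labelled $P^j_d$, and (3)–(5) are understood with these identifications. **The operator $\partial_\phi$.** For $|d|=1$ write $T_{\phi,d}(P)=\mathrm{sgn}_\phi(P,d)$ times the tree with one edge from a vertex labelled $P^1_d$ to a vertex labelled $P^2_d$. $\partial_\phi$ is extended to $\mathcal{P}^{(\star)}_\bullet(R)$ by the Leibniz rule $\partial_\phi(a\wedge b)=(\partial_\phi a)\wedge b+(-1)^ia\wedge\partial_\phi(b)$ for $a$ of exterior degree $i$. *)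

(* Defs.v *)
From HB Require Import structures.
From mathcomp Require Import all_boot all_order all_algebra finmap.
From mathcomp.classical Require Import boolp.
From mathcomp.multinomials Require Import monalg.

Set Implicit Arguments.
Unset Strict Implicit.
Unset Printing Implicit Defensive.

Import GRing.Theory.

Local Open Scope ring_scope.
Local Open Scope quotient_scope.

(* The exterior algebra over rat on the free module with basis X: the free
   associative algebra {malg rat[{fmonom X}]} (words in X) modulo the two-sided
   ideal generated by the squares of the homogeneous elements of degree 1. *)
Section ExteriorAlgebra.
Variable X : choiceType.

Local Notation free := {malg rat[{fmonom X}]}.

Definition free_homog (i : nat) (a : free) : bool :=
  all (fun m : {fmonom X} => fdeg m == i) (msupp a).

Definition ext_ideal : pred free := fun a =>
  `[< exists s : seq (free * free * free),
        (forall t, t \in s -> free_homog 1 t.1.2) /\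
        a = \sum_(t <- s) t.1.1 * t.1.2 ^+ 2 * t.2 >].

Lemma ext_ideal_zmod : zmod_closed ext_ideal.
Proof.
split; first by apply/asboolP; exists [::]; split=> //; rewrite big_nil.
move=> a b /asboolP[s [hs ->]] /asboolP[t [ht ->]]; apply/asboolP.
exists (s ++ [seq (- u.1.1, u.1.2, u.2) | u <- t]); split.
  by move=> u; rewrite mem_cat => /orP[/hs //|/mapP[v /ht h ->]].
rewrite big_cat big_map /= -sumrN; congr (_ + _).
by apply: eq_bigr => u _; rewrite !mulNr.
Qed.

HB.instance Definition _ := GRing.isZmodClosed.Build free ext_ideal ext_ideal_zmod.

Lemma ext_idealMl a b : b \in ext_ideal -> a * b \in ext_ideal.
Proof.
move=> /asboolP[s [hs ->]]; apply/asboolP.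
exists [seq (a * u.1.1, u.1.2, u.2) | u <- s]; split.
  by move=> u /mapP[v /hs h ->].
rewrite big_map mulr_sumr; apply: eq_bigr => u _ /=.
by rewrite 2!(mulrA a).
Qed.

Lemma ext_idealMr a b : a \in ext_ideal -> a * b \in ext_ideal.
Proof.
move=> /asboolP[s [hs ->]]; apply/asboolP.
exists [seq (u.1, u.2 * b) | u <- s]; split.
  by move=> u /mapP[v /hs h ->].
rewrite big_map mulr_suml; apply: eq_bigr => u _ /=.
exact/esym/mulrA.
Qed.

Lemma ext_idealZ c a : a \in ext_ideal -> c *: a \in ext_ideal.
Proof. by rewrite -mul_malgC; exact: ext_idealMl. Qed.

Lemma ext_ideal1 : (1 \in ext_ideal) = false.
Proof.
apply/negP => /asboolP[s [hs e1]].
have /eqP := congr1 (@mcoeff {fmonom X} rat (@mone _)) e1.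
rewrite rmorph1 rmorph_sum big_seq big1 ?oner_eq0 // => u us.
rewrite !rmorphM /= [u.1.2@_(mone)](_ : _ = 0) ?mulr0 ?mul0r //.
apply: mcoeff_outdom; apply/negP => /(allP (hs _ us)).
by rewrite fdeg1.
Qed.

Definition ext_closed : zmodClosed free := GRing.ZmodClosed.clone _ ext_ideal _.
Definition extalg : Type := Quotient.quot ext_closed.
HB.instance Definition _ := GRing.Zmodule.on extalg.

Definition ext_proj : free -> extalg := \pi_(Quotient.quot ext_closed).
Definition ext_lift : extalg -> free := @repr _ (Quotient.quot ext_closed).

Lemma ext_liftK x : ext_proj (ext_lift x) = x.
Proof. exact: reprK. Qed.

Lemma ext_projP a b : reflect (ext_proj a = ext_proj b) (a - b \in ext_ideal).
Proof. by rewrite Quotient.idealrBE; exact: eqP. Qed.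

Lemma ext_projK a : ext_lift (ext_proj a) - a \in ext_ideal.
Proof. by apply/ext_projP; rewrite ext_liftK. Qed.

Lemma ext_projD : {morph ext_proj : a b / a + b}.
Proof. by move=> a b; rewrite /ext_proj raddfD. Qed.

Definition ext_one : extalg := ext_proj 1.
Definition ext_mul (x y : extalg) : extalg := ext_proj (ext_lift x * ext_lift y).
Definition ext_scale (c : rat) (x : extalg) : extalg := ext_proj (c *: ext_lift x).

Lemma ext_projM a b : ext_proj (a * b) = ext_mul (ext_proj a) (ext_proj b).
Proof.
apply/esym/ext_projP.
have -> : forall (u v x y : free), u * v - x * y = (u - x) * v + x * (v - y).
  by move=> u v x y; rewrite mulrBl mulrBr addrA subrK.
by apply: rpredD; [apply: ext_idealMr | apply: ext_idealMl]; exact: ext_projK.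
Qed.

Lemma ext_projZ c a : ext_proj (c *: a) = ext_scale c (ext_proj a).
Proof. by apply/esym/ext_projP; rewrite -scalerBr ext_idealZ ?ext_projK. Qed.

Lemma ext_mulA : associative ext_mul.
Proof.
by move=> x y z; rewrite -(ext_liftK x) -(ext_liftK y) -(ext_liftK z) -!ext_projM mulrA.
Qed.

Lemma ext_mul1x : left_id ext_one ext_mul.
Proof. by move=> x; rewrite -(ext_liftK x) -ext_projM mul1r. Qed.

Lemma ext_mulx1 : right_id ext_one ext_mul.
Proof. by move=> x; rewrite -(ext_liftK x) -ext_projM mulr1. Qed.

Lemma ext_mulDl : left_distributive ext_mul +%R.
Proof.
move=> x y z; rewrite -(ext_liftK x) -(ext_liftK y) -(ext_liftK z).
by rewrite -ext_projD -!ext_projM -ext_projD mulrDl.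
Qed.

Lemma ext_mulDr : right_distributive ext_mul +%R.
Proof.
move=> x y z; rewrite -(ext_liftK x) -(ext_liftK y) -(ext_liftK z).
by rewrite -ext_projD -!ext_projM -ext_projD mulrDr.
Qed.

Lemma ext_one_neq0 : ext_one != 0.
Proof.
apply/eqP => h; have : ext_proj 1 = ext_proj 0 by rewrite [RHS]raddf0.
by move/ext_projP; rewrite subr0 ext_ideal1.
Qed.

HB.instance Definition _ := GRing.Zmodule_isNzRing.Build extalg
  ext_mulA ext_mul1x ext_mulx1 ext_mulDl ext_mulDr ext_one_neq0.

Lemma ext_scaleA c d x : ext_scale c (ext_scale d x) = ext_scale (c * d) x.
Proof. by rewrite -(ext_liftK x) -!ext_projZ scalerA. Qed.

Lemma ext_scale1 : left_id 1 ext_scale.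
Proof. by move=> x; rewrite -(ext_liftK x) -!ext_projZ scale1r. Qed.

Lemma ext_scaleDr : right_distributive ext_scale +%R.
Proof.
move=> c x y; rewrite -(ext_liftK x) -(ext_liftK y).
by rewrite -ext_projD -!ext_projZ -ext_projD scalerDr.
Qed.

Lemma ext_scaleDl x : {morph ext_scale^~ x : c d / c + d}.
Proof.
by move=> c d; rewrite -(ext_liftK x) -!ext_projZ -ext_projD scalerDl.
Qed.

HB.instance Definition _ := GRing.Zmodule_isLmodule.Build rat extalg
  ext_scaleA ext_scale1 ext_scaleDr ext_scaleDl.

Lemma ext_scaleAl c x y : ext_scale c (ext_mul x y) = ext_mul (ext_scale c x) y.
Proof.
rewrite -(ext_liftK x) -(ext_liftK y).
by rewrite -ext_projM -!ext_projZ -ext_projM scalerAl.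
Qed.

HB.instance Definition _ := GRing.Lmodule_isLalgebra.Build rat extalg ext_scaleAl.

Lemma free_scaleAr (c : rat) (a b : free) : c *: (a * b) = a * (c *: b).
Proof.
apply/malgP => k; have m := fsubset_refl (msupp a).
have e1 := mcoeffMlw k m (fsubset_refl (msupp b)).
have e2 := mcoeffMlw k m (msuppZ_le c b).
apply: etrans (mcoeffZ c (a * b) k) _; apply: etrans (congr1 _ e1) (etrans _ (esym e2)).
rewrite mulr_sumr; apply: eq_bigr => i _; rewrite mulr_sumr; apply: eq_bigr => j _.
by rewrite mcoeffZ mulrCA mulrnAr.
Qed.

Lemma ext_scaleAr c x y : ext_scale c (ext_mul x y) = ext_mul x (ext_scale c y).
Proof.
rewrite -(ext_liftK x) -(ext_liftK y).
by rewrite -ext_projM -!ext_projZ -ext_projM free_scaleAr.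
Qed.

HB.instance Definition _ := GRing.Lalgebra_isAlgebra.Build rat extalg ext_scaleAr.

Definition ext_gen (x : X) : extalg := ext_proj << fmu x >>.

Definition ext_homog (i : nat) (x : extalg) : Prop :=
  exists2 a : free, free_homog i a & x = ext_proj a.

End ExteriorAlgebra.

Section Trees.
Variable L : choiceType.

Record lgraph := LGraph {
  gsize : nat;
  glab : {ffun 'I_gsize -> L};
  gedges : {set 'I_gsize * 'I_gsize} }.

Definition lgraph_encode (g : lgraph) :
    {n : nat & ({ffun 'I_n -> L} * {set 'I_n * 'I_n})%type} :=
  Tagged (fun n => ({ffun 'I_n -> L} * {set 'I_n * 'I_n})%type) (glab g, gedges g).

Definition lgraph_decode
    (t : {n : nat & ({ffun 'I_n -> L} * {set 'I_n * 'I_n})%type}) : lgraph :=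
  LGraph (tagged t).1 (tagged t).2.

Lemma lgraph_encodeK : cancel lgraph_encode lgraph_decode.
Proof. by case. Qed.

HB.instance Definition _ := Choice.copy lgraph (can_type lgraph_encodeK).

Definition gadj (g : lgraph) (E : {set 'I_(gsize g) * 'I_(gsize g)}) : rel 'I_(gsize g) :=
  fun u v => ((u, v) \in E) || ((v, u) \in E).

(* The underlying unoriented graph is contractible: it is nonempty and connected,
   and has one edge less than it has vertices. *)
Definition is_tree (g : lgraph) : bool :=
  [&& (0 < gsize g)%N,
      [forall u, forall v, connect (gadj (gedges g)) u v]
    & #|gedges g| == (gsize g).-1].

Definition tgraph := {g : lgraph | is_tree g}.
HB.instance Definition _ := Choice.on tgraph.

Definition lgraph_iso (g h : lgraph) : bool :=
  (gsize g == gsize h) &&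
  [exists f : {ffun 'I_(gsize g) -> 'I_(gsize h)},
    [&& injectiveb f,
        [forall u, glab h (f u) == glab g u]
      & [forall u, forall v, ((f u, f v) \in gedges h) == ((u, v) \in gedges g)]]].

Lemma lgraph_isoP g h : reflect
  (gsize g = gsize h /\ exists f : 'I_(gsize g) -> 'I_(gsize h),
    [/\ injective f, forall u, glab h (f u) = glab g u
      & forall u v, ((f u, f v) \in gedges h) = ((u, v) \in gedges g)])
  (lgraph_iso g h).
Proof.
apply: (iffP andP) => [[/eqP e /existsP[f /and3P[/injectiveP i /forallP l /forallP a]]]|].
  split=> //; exists f; split=> // [u|u v]; first exact/eqP.
  by have /forallP/(_ v)/eqP := a u.
case=> e [f [i l a]]; split; first exact/eqP.
apply/existsP; exists (finfun f); apply/and3P; split.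
- by apply/injectiveP => u v; rewrite !ffunE; exact: i.
- by apply/forallP => u; rewrite ffunE l.
- by apply/forallP => u; apply/forallP => v; rewrite !ffunE a.
Qed.

Definition tree_iso (s t : tgraph) : bool := lgraph_iso (val s) (val t).

Lemma tree_iso_equiv : equiv_class_of tree_iso.
Proof.
have sym s t : tree_iso s t -> tree_iso t s.
  move=> /lgraph_isoP[e [f [i l a]]]; apply/lgraph_isoP; split=> //.
  have [|g fK gK] := inj_card_bij i; first by rewrite !card_ord e.
  exists g; split=> [|u|u v]; first exact: can_inj gK.
    by rewrite -l gK.
  by rewrite -a !gK.
split=> [s|s t|t s u].
- by apply/lgraph_isoP; split=> //; exists id; split.
- by apply/idP/idP; exact: sym.
- move=> /lgraph_isoP[e [f [i l a]]] /lgraph_isoP[e' [f' [i' l' a']]].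
  apply/lgraph_isoP; split; first by rewrite e.
  exists (f' \o f); split=> [|x|x y] /=; first exact: inj_comp.
    by rewrite l' l.
  by rewrite a' a.
Qed.

Canonical tree_iso_equivRel := EquivRelPack tree_iso_equiv.
Canonical tree_iso_encModRel := defaultEncModRel tree_iso.

Definition tree := {eq_quot tree_iso}.
HB.instance Definition _ := Choice.on tree.

Definition tree_graph (t : tree) : lgraph := val (repr t : tgraph).

Definition vertex_graph (x : L) : lgraph := @LGraph 1 [ffun=> x] set0.

Lemma vertex_graph_tree x : is_tree (vertex_graph x).
Proof.
rewrite /is_tree /= cards0 eqxx andbT; apply/forallP => u; apply/forallP => v.
by rewrite !ord1 connect0.
Qed.

Definition vertex_tree (x : L) : tree :=
  \pi_tree (exist _ (vertex_graph x) (vertex_graph_tree x) : tgraph).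

(* The labels of the ends of an edge of t; meant for trees with exactly one
   edge, the default x being returned when there is no edge. *)
Definition source_label (x : L) (t : tree) : L :=
  if [pick e in gedges (tree_graph t)] is Some e then glab (tree_graph t) e.1 else x.
Definition target_label (x : L) (t : tree) : L :=
  if [pick e in gedges (tree_graph t)] is Some e then glab (tree_graph t) e.2 else x.

Definition forest := {cmonom tree}.
HB.instance Definition _ := ConomialDef.on forest.

(* The polynomial algebra on the trees: its basis consists of the forests, and
   the product of forests is the disjoint union. *)
Definition forest_alg := {malg rat[forest]}.

Definition forest_of (m : forest) : forest_alg := << m >>.
Definition tree_elt (t : tree) : forest_alg := forest_of (ucm t).

Section Cuts.
Variable g : lgraph.
Implicit Types (c : {set 'I_(gsize g) * 'I_(gsize g)}) (t : {set 'I_(gsize g)}).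

Definition components c : {set {set 'I_(gsize g)}} :=
  [set [set v | connect (gadj (gedges g :\: c)) u v] | u : 'I_(gsize g)].

Definition flows_into c t : bool := [exists e in c, e.2 \in t].
Definition flows_out_of c t : bool := [exists e in c, e.1 \in t].

Definition proper_admissible c : bool :=
  [&& c \subset gedges g, c != set0
    & [forall t in components c, ~~ (flows_into c t && flows_out_of c t)]].

Definition component_graph c t : lgraph :=
  @LGraph #|t| [ffun i => glab g (enum_val i)]
    [set e | (enum_val e.1, enum_val e.2) \in gedges g :\: c].

(* When g is a tree and t is one of its components, component_graph c t is a
   tree, so that the default value is not used. *)
Definition component_forest c t : forest :=
  if insub (component_graph c t) is Some s then ucm (\pi_tree (s : tgraph)) else mone.

Definition cut_L c : forest :=
  \big[mmul/mone]_(t in components c | flows_into c t) component_forest c t.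
Definition cut_R c : forest :=
  \big[mmul/mone]_(t in components c | ~~ flows_into c t) component_forest c t.

End Cuts.
End Trees.

Section ProductMonom.
Variables M N : conomType.

Definition pair_mul (x y : M * N) : M * N := (mmul x.1 y.1, mmul x.2 y.2).

Lemma pair_mulA : associative pair_mul.
Proof. by move=> x y z; rewrite /pair_mul /= !mulmA. Qed.
Lemma pair_mul1m : left_id (mone, mone) pair_mul.
Proof. by case=> x y; rewrite /pair_mul /= !mul1m. Qed.
Lemma pair_mulm1 : right_id (mone, mone) pair_mul.
Proof. by case=> x y; rewrite /pair_mul /= !mulm1. Qed.
Lemma pair_unitm x y :
  pair_mul x y = (mone, mone) -> x = (mone, mone) /\ y = (mone, mone).
Proof. by case: x y => [a b] [c d] [/unitm[-> ->] /unitm[-> ->]]. Qed.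
Lemma pair_mulC : commutative pair_mul.
Proof. by move=> x y; rewrite /pair_mul mulmC [in X in (_, X)]mulmC. Qed.

HB.instance Definition _ := Choice_isMonomialDef.Build (M * N)%type
  pair_mulA pair_mul1m pair_mulm1 pair_unitm.
HB.instance Definition _ := MonomialDef_isConomialDef.Build (M * N)%type pair_mulC.
End ProductMonom.

Section HopfAlgebra.
Variable L : choiceType.
Local Notation T := (forest_alg L).

(* The tensor square, with basis the pairs of forests. *)
Definition forest_alg2 := {malg rat[(forest L * forest L)%type]}.
Local Notation TT := forest_alg2.

Definition tens (a b : T) : TT :=
  \sum_(k <- msupp a) \sum_(l <- msupp b) << a@_k * b@_l *g (k, l) >>.

Definition coprod_tree (t : tree L) : TT :=
  << (ucm t, mone) >> + << (mone, ucm t) >>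
  + \sum_(c | proper_admissible c)
      << (cut_R c : forest L, cut_L (g := tree_graph t) c : forest L) >>.

Definition coprod (x : T) : TT :=
  \sum_(m <- msupp x) x@_m *: \prod_(t <- finsupp m) coprod_tree t ^+ m t.

Definition counit (x : T) : rat := x@_(mone).

Definition convolution (f g : T -> T) (x : T) : T :=
  \sum_(p <- msupp (coprod x)) (coprod x)@_p *: (f << p.1 >> * g << p.2 >>).

Definition is_antipode (S : {linear T -> T}) : Prop :=
  forall x, convolution S id x = (counit x)%:A /\ convolution id S x = (counit x)%:A.

Definition generated_subalg (G : T -> Prop) : T -> Prop := fun x =>
  forall A : {pred T}, GRing.subalg_closed A -> (forall y, G y -> y \in A) -> x \in A.

(* The antipode, being the convolution inverse of the identity, is unique. *)
Definition is_sub_hopf (H : T -> Prop) : Prop :=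
  [/\ [/\ H 1, (forall c x y, H x -> H y -> H (c *: x + y))
        & (forall x y, H x -> H y -> H (x * y))],
      (forall x, H x -> exists2 s : seq (T * T),
         (forall p, p \in s -> H p.1 /\ H p.2)
         & coprod x = \sum_(p <- s) tens p.1 p.2)
    & (forall S, is_antipode S -> forall x, H x -> H (S x))].

End HopfAlgebra.

Section Polygons.
Variable R : choiceType.

(* A polygon of weight n >= 1 is the word x_1 ... x_{n+1}; the trivial polygon of
   weight 0 is the unit of the exterior algebra. Vertices and sides are numbered
   from 0: side j carries the label of index j and goes from vertex j to vertex
   j + 1 modulo the number of sides; the last side is the root. *)
Definition polygon := {s : seq R | (1 < size s)%N}.
HB.instance Definition _ := Choice.on polygon.

Definition nsides (P : polygon) : nat := size (val P).

(* The arrow (i, j) goes from vertex i to side j. *)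
Definition is_arrow (N : nat) (a : 'I_N * 'I_N) : bool :=
  ((a.2 : nat) != a.1) && (a.2.+1 %% N != a.1)%N.

Definition arrow (P : polygon) : finType := {a : 'I_(nsides P) * 'I_(nsides P) | is_arrow a}.

(* On the boundary circle, vertex i has position 2i, and side j is represented
   by its midpoint, at position 2j + 1. Two arrows ending on the same side never
   have to cross, since their end points can be moved along the side. *)
Definition arrow_min (P : polygon) (a : arrow P) : nat :=
  minn (val a).1.*2 (val a).2.*2.+1.
Definition arrow_max (P : polygon) (a : arrow P) : nat :=
  maxn (val a).1.*2 (val a).2.*2.+1.

Definition crossing (P : polygon) (a b : arrow P) : bool :=
  (arrow_min a < arrow_min b < arrow_max a)%N && (arrow_max a < arrow_max b)%N ||
  (arrow_min b < arrow_min a < arrow_max b)%N && (arrow_max b < arrow_max a)%N.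

Definition is_dissection (P : polygon) (d : {set arrow P}) : bool :=
  [forall a in d, forall b in d, ~~ crossing a b].

Definition dissection (P : polygon) : finType := {d : {set arrow P} | is_dissection d}.

Definition arrows (P : polygon) (d : dissection P) : {set arrow P} := val d.

Lemma is_dissection0 P : is_dissection (set0 : {set arrow P}).
Proof. by apply/forall_inP => a; rewrite inE. Qed.

Definition empty_dissection (P : polygon) : dissection P :=
  exist _ set0 (is_dissection0 P).

(* dt_neg is true when the sign is -1. *)
Record dual_tree_gen := DualTreeGen {
  dt_neg : forall P : polygon, dissection P -> bool;
  dt_tree : forall P : polygon, dissection P -> tree polygon;
  dt_neg_empty : forall P, dt_neg (empty_dissection P) = false;
  dt_tree_empty : forall P, dt_tree (empty_dissection P) = vertex_tree P }.

Section DualTrees.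
Variable phi : dual_tree_gen.

Definition dt_sgn (P : polygon) (d : dissection P) : rat := (-1) ^+ dt_neg phi d.

Definition dt_elt (P : polygon) (d : dissection P) : forest_alg polygon :=
  dt_sgn d *: tree_elt (dt_tree phi d).

Definition dt_subalg : forest_alg polygon -> Prop :=
  generated_subalg (fun x => exists P (d : dissection P), x = dt_elt d).

(* The correspondence between arrows and edges, on explicit models of the trees
   T_d(P): the vertices are the elements of 'I_(#|d| + 1), labelled by ac_lab,
   and the edge corresponding to an arrow a in d goes from ac_src d a to
   ac_tgt d a (the values at the other arrows are irrelevant). ac_contr d j
   identifies the arrows of the polygon labelling the vertex j with arrows of P,
   by contraction of the arrows of d. *)
Record arrow_correspondence := ArrowCorrespondence {
  ac_lab : forall P (d : dissection P), 'I_(#|arrows d|.+1) -> polygon;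
  ac_src : forall P (d : dissection P), arrow P -> 'I_(#|arrows d|.+1);
  ac_tgt : forall P (d : dissection P), arrow P -> 'I_(#|arrows d|.+1);
  ac_contr : forall P (d : dissection P) (j : 'I_(#|arrows d|.+1)),
    arrow (ac_lab j) -> arrow P }.
Arguments ac_lab K {P} d j : rename.
Arguments ac_src K {P} d a : rename.
Arguments ac_tgt K {P} d a : rename.
Arguments ac_contr {K P d j} a : rename.

Section Compatibility.
Variable K : arrow_correspondence.

Definition edges_are_arrows : Prop :=
  forall (P : polygon) (d : dissection P),
  let t := tree_graph (dt_tree phi d) in
  exists f : 'I_(#|arrows d|.+1) -> 'I_(gsize t),
    [/\ bijective f,
        (forall v, glab t (f v) = ac_lab K d v),
        {in arrows d &, injective (fun a => (ac_src K d a, ac_tgt K d a))}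
      & gedges t = [set (f (ac_src K d a), f (ac_tgt K d a)) | a in arrows d]].

Definition expand (P : polygon) (d : dissection P)
    (dl : forall j, dissection (ac_lab K d j)) : {set arrow P} :=
  arrows d :|: \bigcup_j [set ac_contr a | a in arrows (dl j)].

Definition contraction_bijective : Prop :=
  forall (P : polygon) (d : dissection P),
  [/\ (forall dl, is_dissection (expand (d := d) dl)),
      (forall d' : dissection P, arrows d \subset arrows d' ->
         exists dl, arrows d' = expand (d := d) dl)
    & (forall dl dl', expand (d := d) dl = expand dl' -> forall j, dl j = dl' j)].

Definition ac_adj (P : polygon) (d : dissection P) (e : {set arrow P}) :
    rel 'I_(#|arrows d|.+1) := fun u v =>
  [exists a in e, ((ac_src K d a, ac_tgt K d a) == (u, v)) ||
                  ((ac_src K d a, ac_tgt K d a) == (v, u))].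
Arguments ac_adj {P} d e u v.

(* The components of T_{d'}(P) with the edges d removed are the fibres of the
   contraction p onto T_d(P), and the edges of the j-th one are dl j. *)
Definition contraction_components : Prop :=
  forall (P : polygon) (d d' : dissection P) (dl : forall j, dissection (ac_lab K d j)),
  arrows d' = expand dl ->
  exists p : 'I_(#|arrows d'|.+1) -> 'I_(#|arrows d|.+1),
    [/\ (forall u v, p u = p v <-> connect (ac_adj d' (arrows d' :\: arrows d)) u v),
        {in arrows d, forall a, p (ac_src K d' a) = ac_src K d a},
        {in arrows d, forall a, p (ac_tgt K d' a) = ac_tgt K d a}
      & forall j, {in arrows (dl j), forall a,
          p (ac_src K d' (ac_contr a)) = j /\ p (ac_tgt K d' (ac_contr a)) = j}].

Definition inner_arrows (P : polygon) (d : dissection P)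
    (S : {set 'I_(#|arrows d|.+1)}) : {set arrow P} :=
  [set a in arrows d | (ac_src K d a \in S) && (ac_tgt K d a \in S)].

(* S is the vertex set of a subtree of T_d(P); the edges of the subtree
   correspond to inner_arrows S. *)
Definition is_subtree (P : polygon) (d : dissection P)
    (S : {set 'I_(#|arrows d|.+1)}) : Prop :=
  S != set0 /\ {in S &, forall u v, connect (ac_adj d (inner_arrows S)) u v}.

(* T_dQ(Q) is the subtree of T_d(P) on S, for Q the label of the vertex j of
   T_d0(P). *)
Definition subtree_realized (P : polygon) (d d0 : dissection P)
    (S : {set 'I_(#|arrows d|.+1)}) (j : 'I_(#|arrows d0|.+1))
    (dQ : dissection (ac_lab K d0 j)) : Prop :=
  exists f : 'I_(#|arrows dQ|.+1) -> 'I_(#|arrows d|.+1),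
    [/\ injective f, [set f v | v : 'I_(#|arrows dQ|.+1)] = S,
        (forall v, ac_lab K d (f v) = ac_lab K dQ v)
      & {in arrows dQ, forall a,
           ac_src K d (ac_contr a) = f (ac_src K dQ a) /\
           ac_tgt K d (ac_contr a) = f (ac_tgt K dQ a)}].

(* T_d0(P) is obtained from T_d(P) by replacing the subtree on S by j. *)
Definition subtree_replaced (P : polygon) (d d0 : dissection P)
    (S : {set 'I_(#|arrows d|.+1)}) (j : 'I_(#|arrows d0|.+1)) : Prop :=
  exists p : 'I_(#|arrows d|.+1) -> 'I_(#|arrows d0|.+1),
    [/\ (forall v, (p v == j) = (v \in S)),
        {in ~: S &, injective p} /\ (forall w, exists v, p v = w),
        {in ~: S, forall v, ac_lab K d0 (p v) = ac_lab K d v}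
      & {in arrows d0, forall a,
           ac_src K d0 a = p (ac_src K d a) /\ ac_tgt K d0 a = p (ac_tgt K d a)}].

Definition subtree_compatible : Prop :=
  forall (P : polygon) (d d0 : dissection P) (S : {set 'I_(#|arrows d|.+1)}),
  is_subtree S -> arrows d0 = arrows d :\: inner_arrows S ->
  exists (j : 'I_(#|arrows d0|.+1)) (dQ : dissection (ac_lab K d0 j)),
    [/\ [set ac_contr a | a in arrows dQ] = inner_arrows S,
        subtree_realized S dQ,
        subtree_replaced S j
      & dt_sgn d = dt_sgn dQ * dt_sgn d0].

End Compatibility.

Definition dissection_compatible : Prop :=
  is_sub_hopf dt_subalg /\
  exists K : arrow_correspondence,
    [/\ edges_are_arrows K, contraction_bijective K, contraction_components K
      & subtree_compatible K].

Local Notation E := (extalg polygon).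

Definition dt_boundary (P : polygon) : E :=
  \sum_(d : dissection P | #|arrows d| == 1%N)
     dt_sgn d *: (ext_gen (source_label P (dt_tree phi d)) *
                  ext_gen (target_label P (dt_tree phi d))).

End DualTrees.
End Polygons.

Definition degree1_derivation (X : choiceType) (D : extalg X -> extalg X) : Prop :=
  [/\ linear D,
      (forall i a, ext_homog i a -> ext_homog i.+1 (D a))
    & forall i a b, ext_homog i a -> D (a * b) = D a * b + (-1) ^+ i *: (a * D b)].

(* Main.v *)
Require Import Defs.
From HB Require Import structures.
From mathcomp Require Import all_boot all_order all_algebra finmap.
From mathcomp.classical Require Import boolp.
From mathcomp.multinomials Require Import monalg.

Set Implicit Arguments.
Unset Strict Implicit.
Unset Printing Implicit Defensive.

Import GRing.Theory.

Local Open Scope ring_scope.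

(** Write [g P] for the generator of the exterior algebra attached to the
    polygon [P]. A degree one derivation of an exterior algebra may take
    arbitrary values of degree 2 on the generators, and is determined by them
    ([derivation_exists], [derivation_ext]); as its square satisfies
    [D (D (g x * y)) = D (D (g x)) * y + g x * D (D y)], it vanishes as soon as
    it vanishes on the generators ([derivation_square]).

    The content is therefore that [D] kills the element [dt_boundary phi P].
    Expanding [D] of that element gives a sum over the arrows [a] of [P] and
    over the arrows [x] of the two polygons into which [a] cuts [P]. Contraction
    identifies such an [x] with an arrow [b] of [P] different from [a] and not
    crossing it, and [b] comes from only one [x]: so the sum runs over ordered
    pairs [(a, b)] such that [d = {a, b}] is a dissection ([sum_summand],
    [contr_inj], [inner_sum_eq0]).

    The tree of [d] has three vertices and two edges, hence is a path, and
    exactly one end of [a] lies on the edge [b] ([pair_path]). Compatibility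
    with subtrees, applied to the subtree with the single edge [b], expresses
    the term of [(a, b)] through the tree of [d] alone ([summand_pair]): up to
    the sign of [d] it is the product [b1 * b2 * a2] when the source [a1] of [a]
    is on [b], and [- a1 * b1 * b2] when its target [a2] is, where [b1] and [b2]
    are the ends of [b]. The four orientations of the path then show that the
    terms of [(a, b)] and [(b, a)] cancel, by anticommutation of the generators
    ([pair_value_anti]). *)

(** * Degree one derivations of an exterior algebra *)

Section ExteriorAlgebra.
Variable X : choiceType.

Local Notation free := {malg rat[{fmonom X}]}.

Lemma malg_basis_sum (a : free) : a = \sum_(k <- msupp a) a@_k *: << k >>.
Proof.
rewrite {1}[a]monalgE; apply: eq_bigr => k _.
by apply/malgP => l; rewrite mcoeffZ !mcoeffU mulrnAr mulr1.
Qed.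

Lemma malgU_mul (v w : {fmonom X}) : << mmul v w >> = << v >> * << w >> :> free.
Proof. by rewrite malgM_def fgmulUU mulr1. Qed.

(** Words are built one letter at a time, which is how derivations are
    computed. *)
Lemma fmonom_ind (P : {fmonom X} -> Prop) :
  P mone -> (forall x w, P w -> P (mmul (fmu x) w)) -> forall w, P w.
Proof.
move=> P1 Pmul [s]; elim: s => [|x s IHs]; first by rewrite -fmoneE.
suff <- : mmul (fmu x) (FMonom s) = FMonom (x :: s) by exact: Pmul.
by rewrite [LHS]fmmulE fmU.
Qed.

Lemma fdeg1P (w : {fmonom X}) : fdeg w = 1%N -> exists x, w = fmu x.
Proof.
elim/fmonom_ind: w => [|x w _]; first by rewrite fdeg1.
rewrite fdegM fdegU => -[] /eqP; rewrite fdeg_eq0 => /eqP->.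
by exists x; rewrite mulm1.
Qed.

Lemma free_homog_ind i (P : free -> Prop) :
  P 0 -> (forall c a b, P a -> P b -> P (c *: a + b)) ->
  (forall w, fdeg w = i -> P << w >>) -> forall a, free_homog i a -> P a.
Proof.
move=> P0 Plin Pword a /allP ha; rewrite [a]malg_basis_sum big_seq.
by elim/big_rec: _ => [//|w x /ha /eqP dw Px]; apply: Plin => //; apply: Pword.
Qed.

Lemma free_homog_lin i c (a b : free) :
  free_homog i a -> free_homog i b -> free_homog i (c *: a + b).
Proof.
move=> /allP ha /allP hb; apply/allP => k.
move=> /(fsubsetP (msuppD_le _ _)); rewrite inE => /orP[|/hb//].
by move=> /(fsubsetP (msuppZ_le _ _)) /ha.
Qed.

Lemma free_homog_word w : free_homog (fdeg w) (<< w >> : free).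
Proof. by apply/allP => k /(fsubsetP msuppU_le); rewrite inE => /eqP->. Qed.

(** The exterior algebra enters only as a quotient [proj] of the free algebra,
    with a section [lift]. Its carrier is kept abstract because unification would
    otherwise compare elements by unfolding their representatives. *)
Variables (E : algType rat) (proj : {linear free -> E}) (lift : E -> free).
Hypothesis proj1 : proj 1 = 1.
Hypothesis projM : forall a b : free, proj (a * b) = proj a * proj b.
Hypothesis liftK : cancel lift proj.
Hypothesis proj_ker : forall a b : free, proj a = proj b <-> a - b \in @ext_ideal X.

Definition homog i (x : E) : Prop := exists2 a, free_homog i a & x = proj a.
Definition word (w : {fmonom X}) : E := proj << w >>.
Definition gen (x : X) : E := word (fmu x).

Definition derivation (D : E -> E) : Prop :=
  [/\ linear D,
      (forall i a, homog i a -> homog i.+1 (D a))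
    & forall i a b, homog i a -> D (a * b) = D a * b + (-1) ^+ i *: (a * D b)].

Lemma word1 : word mone = 1.
Proof. exact: proj1. Qed.

Lemma wordM v w : word (mmul v w) = word v * word w.
Proof. by rewrite /word malgU_mul projM. Qed.

Lemma homog_ind i (P : E -> Prop) :
  P 0 -> (forall c x y, P x -> P y -> P (c *: x + y)) ->
  (forall w, fdeg w = i -> P (word w)) -> forall x, homog i x -> P x.
Proof.
move=> P0 Plin Pword _ [a ha ->].
move: a ha; apply: free_homog_ind => [|c a b Pa Pb|w]; last exact: Pword.
  by rewrite linear0.
by rewrite linearP; apply: Plin.
Qed.

Lemma word_ind (P : E -> Prop) :
  (forall c x y, P x -> P y -> P (c *: x + y)) ->
  P 1 -> (forall x w, P (word w) -> P (gen x * word w)) -> forall x, P x.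
Proof.
move=> Plin P1 Pgen x; rewrite -[x]liftK [lift x]malg_basis_sum linear_sum.
have P0 : P 0 by rewrite -[0](addNr 1) -scaleN1r; apply: Plin.
elim/big_rec: _ => [//|w y _ Py]; rewrite linearZ; apply: Plin => {Py}//.
elim/fmonom_ind: w => [|z w Pw]; first by rewrite -/(word mone) word1.
by rewrite -/(word _) wordM; apply: Pgen.
Qed.

Lemma homog0 i : homog i 0.
Proof. by exists 0; rewrite ?linear0 // /free_homog msupp0. Qed.

Lemma homog_lin i c x y : homog i x -> homog i y -> homog i (c *: x + y).
Proof.
move=> [a ha ->] [b hb ->]; exists (c *: a + b); last by rewrite linearP.
exact: free_homog_lin.
Qed.

Lemma homog_word w : homog (fdeg w) (word w).
Proof. by exists << w >>; first exact: free_homog_word. Qed.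

Lemma homog_gen x : homog 1 (gen x).
Proof. by rewrite -(fdegU x); apply: homog_word. Qed.

Lemma homogM i j x y : homog i x -> homog j y -> homog (i + j) (x * y).
Proof.
move=> hx; move: y; apply: homog_ind => [|c y z hy hz|w <-].
- by rewrite mulr0; apply: homog0.
- by rewrite mulrDr -scalerAr; apply: homog_lin.
move: x hx; apply: homog_ind => [|c y z hy hz|v <-].
- by rewrite mul0r; apply: homog0.
- by rewrite mulrDl -scalerAl; apply: homog_lin.
by rewrite -wordM -fdegM; apply: homog_word.
Qed.

Lemma homog1_sqr x : homog 1 x -> x * x = 0.
Proof.
move=> [a ha ->]; rewrite -projM -(linear0 proj).
apply/proj_ker; rewrite subr0; apply/asboolP; exists [:: (1, a, 1)]; split.
  by move=> t; rewrite inE => /eqP->.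
by rewrite big_seq1 mul1r mulr1 expr2.
Qed.

Lemma gen_anticomm x y : gen x * gen y = - (gen y * gen x).
Proof.
have gx := homog_gen x; have gy := homog_gen y.
have /homog1_sqr := homog_lin 1 gx gy; rewrite scale1r.
rewrite mulrDl !mulrDr !homog1_sqr // add0r addr0 => /eqP.
by rewrite addr_eq0 => /eqP.
Qed.

(** Moving a generator past a product of two generators changes the sign twice. *)
Lemma homog2_comm x y : homog 2 x -> GRing.comm x y.
Proof.
have commL (z : E) c u v : GRing.comm z u -> GRing.comm z v -> GRing.comm z (c *: u + v).
  by move=> zu; apply: commrD; rewrite /GRing.comm -scalerAr zu scalerAl.
move=> hx; move: y; apply: word_ind => [c' y z||z w]; first exact: commL.
  exact: commr1.
apply: commrM; apply: commr_sym; move: x hx.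
apply: homog_ind => [|c x y|w']; [exact: commr0|exact: commL|].
elim/fmonom_ind: w' => [|x w' _]; first by rewrite fdeg1.
rewrite fdegM fdegU => -[] /fdeg1P[y ->].
rewrite wordM -/(gen x) -/(gen y) /GRing.comm mulrA (gen_anticomm z x).
by rewrite mulNr -(mulrA _ (gen z)) (gen_anticomm z y) mulrN opprK mulrA.
Qed.

(** A derivation is first constructed on the free algebra, with values in the
    quotient. On words it is forced: by the Leibniz rule its value on a word is
    computed from its value on the first letter and on the remaining word. *)
Section LinearExtension.
Variable delta : X -> E.

Fixpoint word_der (s : seq X) : E :=
  if s is x :: s' then delta x * word (FMonom s') - gen x * word_der s' else 0.

Definition free_der (a : free) : E := \sum_(k <- msupp a) a@_k *: word_der k.

Lemma free_derEw (d : {fset {fmonom X}}) a : (msupp a `<=` d)%fset ->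
  free_der a = \sum_(k <- d) a@_k *: word_der k.
Proof.
move=> le_ad; rewrite /free_der (big_fset_incl _ le_ad) // => k _.
by rewrite -mcoeff_eq0 => /eqP->; rewrite scale0r.
Qed.

Fact free_der_linear : linear free_der.
Proof.
move=> c a b; pose d := (msupp a `|` msupp b)%fset.
rewrite !(@free_derEw d); first last.
- by apply: fsubset_trans (msuppD_le _ _) _; apply: fsetSU; apply: msuppZ_le.
- exact: fsubsetUl.
- exact: fsubsetUr.
rewrite scaler_sumr -big_split; apply: eq_bigr => k _ /=.
by rewrite mcoeffD mcoeffZ scalerDl scalerA.
Qed.

HB.instance Definition _ :=
  GRing.isLinear.Build rat free E *:%R free_der free_der_linear.

Lemma free_der_word w : free_der << w >> = word_der w.
Proof. by rewrite (free_derEw msuppU_le) big_seq_fset1 mcoeffUU scale1r. Qed.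

(** Later arguments only use these two equations, with an abstract linear map in
    place of the explicit sum. *)
Lemma free_der_exists : exists F : {linear free -> E}, F << mone >> = 0 /\
  forall x (w : {fmonom X}),
    F << mmul (fmu x) w >> = delta x * word w - gen x * F << w >>.
Proof.
exists free_der; split=> [|x w] /=; first by rewrite free_der_word fm1.
by rewrite !free_der_word fmM fmU /=; case: w.
Qed.

End LinearExtension.

(** The free derivation kills the ideal, so that it factors through the
    quotient. *)
Section Descent.
Variables (delta : X -> E) (F : {linear free -> E}).
Hypothesis homog_delta : forall x, homog 2 (delta x).
Hypothesis F1 : F << mone >> = 0.
Hypothesis F_cons : forall x (w : {fmonom X}),
  F << mmul (fmu x) w >> = delta x * word w - gen x * F << w >>.

Lemma free_der_gen x : F << fmu x >> = delta x.
Proof. by rewrite -[fmu x]mulm1 F_cons word1 mulr1 F1 mulr0 subr0. Qed.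

Lemma free_der_leibniz_word v b :
  F (<< v >> * b) = F << v >> * proj b + (-1) ^+ fdeg v *: (word v * F b).
Proof.
rewrite [b]malg_basis_sum mulr_sumr !linear_sum !mulr_sumr scaler_sumr -big_split.
apply: eq_bigr => w _ /=.
rewrite -free_scaleAr !linearZ -!scalerAr !scalerA [_ ^+ _ * _]mulrC -scalerA -scalerDr.
congr (_ *: _); rewrite -malgU_mul /= -/(word w); elim/fmonom_ind: v => [|x v IHv].
  by rewrite mul1m F1 mul0r add0r fdeg1 expr0 scale1r word1 mul1r.
have -> : (-1) ^+ fdeg (mmul (fmu x) v) = - (-1) ^+ fdeg v :> rat.
  by rewrite fdegM fdegU exprS mulN1r.
rewrite -mulmA (F_cons x (mmul v w)) IHv (F_cons x v) !wordM -/(gen x).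
by rewrite mulrBl mulrDr opprD -scalerAr scaleNr !mulrA addrA.
Qed.

Lemma free_der_leibniz i a b : free_homog i a ->
  F (a * b) = F a * proj b + (-1) ^+ i *: (proj a * F b).
Proof.
move: a; apply: free_homog_ind => [|c a a' IHa IHa'|w <-].
- by rewrite !(mul0r, linear0, scaler0) addr0.
- have -> : (c *: a + a') * b = c *: (a * b) + a' * b by rewrite mulrDl -scalerAl.
  apply: etrans (linearP F c (a * b) (a' * b)) _.
  apply: etrans (congr2 (fun u v => c *: u + v) IHa IHa') _.
  rewrite (linearP F c a a') (linearP proj c a a') /=.
  by rewrite !mulrDl -!scalerAl !scalerDr !scalerA [c * _]mulrC addrACA.
exact: free_der_leibniz_word.
Qed.

(** For [y] of degree 1, [F (y * y) = F y * proj y - proj y * F y] vanishes since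
    [F y] has degree 2 and hence is central. The factor on the left of a
    generator of the ideal need not be homogeneous, and is split into words. *)
Lemma free_der_ideal a : a \in @ext_ideal X -> F a = 0.
Proof.
move=> /asboolP[s [hs ->]]; rewrite linear_sum big_seq big1 // => -[[u y] v] /hs /= hy.
have yy0 : proj y * proj y = 0 by apply: homog1_sqr; exists y.
have Fy z : GRing.comm (F y) z.
  apply: homog2_comm; move: y hy {yy0}; apply: free_homog_ind.
  - by rewrite linear0; apply: homog0.
  - by move=> c y1 y2 hy1 hy2; rewrite linearP; apply: homog_lin.
  by move=> w /fdeg1P[x ->]; rewrite free_der_gen.
have Fyyv : F (y * (y * v)) = 0.
  rewrite !(free_der_leibniz _ hy) projM !expr1 !scaleN1r mulrBr !mulrA yy0.
  by rewrite mul0r subr0 (Fy (proj y)) subrr.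
have pyyv : proj (y * (y * v)) = 0 by rewrite !projM mulrA yy0 mul0r.
(* Proved in an arbitrary ring to keep the free algebra folded. *)
have mulA4 (A : pzRingType) (x1 x2 x3 : A) :
  x1 * x2 ^+ 2 * x3 = x1 * (x2 * (x2 * x3)).
  by rewrite expr2 !mulrA.
rewrite mulA4.
move: (y * (y * v)) Fyyv pyyv => b Fb pb.
rewrite [u]malg_basis_sum mulr_suml linear_sum big1 // => w _.
by rewrite -scalerAl linearZ /= free_der_leibniz_word Fb pb !mulr0 scaler0 addr0 scaler0.
Qed.

Lemma free_der_lift a : F (lift (proj a)) = F a.
Proof.
apply/eqP; rewrite -subr_eq0 -linearB /=; apply/eqP/free_der_ideal.
by apply/proj_ker; rewrite liftK.
Qed.

Lemma descent_derivation : derivation (F \o lift).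
Proof.
have lin : linear (F \o lift).
  by move=> c x y; rewrite -[x]liftK -[y]liftK -linearP /= !free_der_lift linearP.
split=> // i.
- apply: homog_ind => [|c x y hx hy|w <-].
  + by rewrite -(linear0 proj) /= free_der_lift linear0; apply: homog0.
  + by rewrite lin; apply: homog_lin.
  rewrite /= free_der_lift; elim/fmonom_ind: w => [|x w IHw].
    by rewrite F1; apply: homog0.
  rewrite F_cons fdegM fdegU addrC -scaleN1r; apply: homog_lin.
    exact: homogM (homog_gen x) IHw.
  exact: homogM (homog_delta x) (homog_word w).
move=> _ y [a ha ->]; rewrite -[y]liftK -projM /= !free_der_lift.
exact: free_der_leibniz.
Qed.

End Descent.

(** An exterior algebra is free as a graded commutative algebra: the values of a
    derivation on generators can be prescribed. *)
Lemma derivation_exists (delta : X -> E) : (forall x, homog 2 (delta x)) ->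
  exists2 D, derivation D & forall x, D (gen x) = delta x.
Proof.
move=> hdelta; have [F [F1 F_cons]] := free_der_exists delta.
exists (F \o lift); first exact: descent_derivation hdelta F1 F_cons.
by move=> x; rewrite /= (free_der_lift hdelta F1 F_cons) (free_der_gen F1 F_cons).
Qed.

Section DerivationTheory.
Variable D : E -> E.
Hypothesis derD : derivation D.

Lemma derivation_linear : linear D. Proof. by case: derD. Qed.

Lemma derivation0 : D 0 = 0.
Proof.
have := derivation_linear 1 0 0; rewrite !scale1r !addr0 => /esym/eqP.
by rewrite -subr_eq0 addrK => /eqP.
Qed.

Lemma derivation1 : D 1 = 0.
Proof.
have h1 : homog 0 1 by rewrite -word1 -(@fdeg1 X); apply: homog_word.
have [_ _ /(_ 0%N 1 1 h1)] := derD; rewrite expr0 scale1r !mulr1 mul1r => /esym/eqP.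
by rewrite -subr_eq0 addrK => /eqP.
Qed.

Lemma derivation_genM x y : D (gen x * y) = D (gen x) * y - gen x * D y.
Proof.
by have [_ _ leib] := derD; rewrite (leib 1%N _ _ (homog_gen x)) expr1 scaleN1r.
Qed.

(** The mixed terms [D (gen x) * D y] of [D (D (gen x * y))] cancel because
    [D (gen x)] has even degree. *)
Lemma derivation_square :
  (forall x, D (D (gen x)) = 0) -> forall x, D (D x) = 0.
Proof.
move=> DD0; apply: word_ind => [c x y DDx DDy||x w DDw].
- by rewrite !derivation_linear DDx DDy scaler0 addr0.
- by rewrite derivation1 derivation0.
have [_ hD leib] := derD; rewrite derivation_genM -scaleN1r addrC derivation_linear.
rewrite (leib 2%N _ _ (hD _ _ (homog_gen x))) DD0 mul0r add0r sqrrN expr1n scale1r.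
by rewrite derivation_genM DDw mulr0 subr0 scaleN1r addNr.
Qed.

End DerivationTheory.

Lemma derivation_ext D D' : derivation D -> derivation D' ->
  (forall x, D' (gen x) = D (gen x)) -> forall x, D' x = D x.
Proof.
move=> derD derD' eqD; apply: word_ind => [c x y Dx Dy||x w Dw].
- by rewrite !derivation_linear // Dx Dy.
- by rewrite !derivation1.
by rewrite (derivation_genM derD) (derivation_genM derD') eqD Dw.
Qed.

End ExteriorAlgebra.

(** * Trees of dissections with one arrow *)

Lemma connect_neighbour (T : finType) (e : rel T) x y :
  connect e x y -> x != y -> exists2 z, z != x & e x z.
Proof.
case/connectP => s; case/shortenP => -[|z s'] /=; first by move=> _ _ _ ->; rewrite eqxx.
case/andP=> exz _ /andP[xs _] _ _ _; exists z => //.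
by apply: contraNneq xs => <-; rewrite mem_head.
Qed.

Section Boundary.
Variables (R : choiceType) (phi : dual_tree_gen R) (K : arrow_correspondence R).
Implicit Type P : polygon R.

Hypothesis edgesP : edges_are_arrows phi K.
Hypothesis contrP : contraction_bijective K.
Hypothesis subtreeP : subtree_compatible phi K.

Local Notation lab d a := (@ac_lab _ K _ d a).
Local Notation src d a := (@ac_src _ K _ d a).
Local Notation tgt d a := (@ac_tgt _ K _ d a).

(** A tree with at least one edge has no isolated vertex, even if loops are not
    counted as edges. *)
Lemma vertex_on_edge P (d : dissection P) (v : 'I_(#|arrows d|.+1)) :
  (0 < #|arrows d|)%N ->
  exists a, [/\ a \in arrows d, src d a != tgt d a & (v == src d a) || (v == tgt d a)].
Proof.
move=> d_gt0; have [w vw] : exists w : 'I_(#|arrows d|.+1), v != w.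
  by have [->|] := eqVneq v ord0; [exists ord_max; rewrite eq_sym -lt0n|exists ord0].
have [f [[g fK gK] _ _ eqE]] := edgesP d.
have /and3P[_ /forallP/(_ (f v))/forallP/(_ (f w)) conn _] :=
  valP (repr (dt_tree phi d) : tgraph _).
have [|z] := connect_neighbour conn; first by rewrite (can_eq fK).
move=> zv; rewrite /gadj.
rewrite -[gedges _]/(gedges (tree_graph (dt_tree phi d))) eqE.
case/orP => /imsetP[a ad [e1 e2]]; exists a; split=> //.
- by rewrite -(can_eq fK) -e1 -e2 eq_sym.
- by rewrite (can_inj fK e1) eqxx.
- by rewrite -(can_eq fK) -e1 -e2.
- by rewrite (can_inj fK e2) eqxx orbT.
Qed.

Lemma is_dissection1 P (a : arrow P) : is_dissection [set a].
Proof.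
apply/forall_inP => x /set1P->; apply/forall_inP => y /set1P->.
by rewrite /crossing !ltnn.
Qed.

Definition single P (a : arrow P) : dissection P :=
  exist (fun d => is_true (is_dissection d)) [set a] (is_dissection1 a).

Lemma card1_single P (d : dissection P) : #|arrows d| = 1%N -> exists a, d = single a.
Proof. by move=> /eqP/cards1P[a da]; exists a; apply: val_inj. Qed.

Lemma single_src_neq_tgt P (a : arrow P) : src (single a) a != tgt (single a) a.
Proof.
have [|b [/set1P-> //]] := @vertex_on_edge _ (single a) ord0.
by rewrite cards1.
Qed.

Lemma single_vertex P (a : arrow P) j :
  (j == src (single a) a) || (j == tgt (single a) a).
Proof.
set s := src _ _; set t := tgt _ _.
have: #|[set s; t]| = #|'I_(#|arrows (single a)|.+1)|.
  by rewrite cards2 single_src_neq_tgt card_ord cards1.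
move=> e; have: [set s; t] = [set: 'I_(#|arrows (single a)|.+1)].
  by apply/eqP; rewrite eqEcard subsetT cardsT e leqnn.
by move/setP/(_ j); rewrite !inE.
Qed.

Definition src_lab P (a : arrow P) := lab (single a) (src (single a) a).
Definition tgt_lab P (a : arrow P) := lab (single a) (tgt (single a) a).

Lemma single_end_labels P (a : arrow P) x :
  source_label x (dt_tree phi (single a)) = src_lab a /\
  target_label x (dt_tree phi (single a)) = tgt_lab a.
Proof.
have [f [_ labE _ eqE]] := edgesP (single a).
rewrite /source_label /target_label eqE.
case: pickP => [e /imsetP[b /set1P-> ->]|].
  by rewrite !labE.
by move/(_ (f (src (single a) a), f (tgt (single a) a))); rewrite imset_f // inE.
Qed.

(** * Contraction of a dissection *)

Definition vertex_arrow (P : polygon R) (d : dissection P) : finType :=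
  {j : 'I_(#|arrows d|.+1) & arrow (lab d j)}.

Definition contr P (d : dissection P) (u : vertex_arrow d) : arrow P :=
  ac_contr (tagged u).

(** The family of dissections with the arrow [tagged u] at the vertex [tag u] and
    nothing elsewhere; it corresponds to the dissection obtained from [d] by
    adding one arrow, which turns the properties of the contraction bijection
    into properties of [contr]. *)
Definition fill1 P (d : dissection P) (u : vertex_arrow d) :
    forall j, dissection (lab d j) :=
  dfwith (fun j => empty_dissection (lab d j)) (single (tagged u)).

Lemma expand_empty P (d : dissection P) :
  expand (fun j => empty_dissection (lab d j)) = arrows d.
Proof.
by rewrite /expand big1 ?setU0 // => j _; rewrite imset0.
Qed.

Lemma expand_fill1 P (d : dissection P) (u : vertex_arrow d) :
  expand (fill1 u) = contr u |: arrows d.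
Proof.
rewrite setUC /expand /fill1 (bigD1 (tag u)) //= dfwith_in imset_set1.
rewrite big1 ?setU0 // => j ju.
by rewrite dfwith_out ?imset0 // eq_sym.
Qed.

Lemma contr_dissection P (d : dissection P) (u : vertex_arrow d) :
  is_dissection (contr u |: arrows d).
Proof. by have [+ _ _] := contrP d; rewrite -expand_fill1; apply. Qed.

Lemma single_neq0 P (a : arrow P) : single a <> empty_dissection P.
Proof. by move/(congr1 (@arrows _ P))/setP/(_ a); rewrite !inE eqxx. Qed.

Lemma single_inj P : injective (@single P).
Proof. by move=> a b /(congr1 (@arrows _ P))/set1_inj. Qed.

(** If [contr u] were in [d], then [fill1 u] and the empty family would expand to
    the same dissection. *)
Lemma contr_notin P (d : dissection P) (u : vertex_arrow d) : contr u \notin arrows d.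
Proof.
apply/negP => ud; have [_ _ inj] := contrP d.
have := inj (fill1 u) (fun j => empty_dissection (lab d j)).
rewrite expand_empty expand_fill1 (setUidPr _) ?sub1set // => /(_ erefl (tag u)).
by rewrite /fill1 dfwith_in => /single_neq0.
Qed.

Lemma contr_inj P (d : dissection P) : injective (@contr P d).
Proof.
move=> [j x] [i y] eq_uv; have [_ _ inj] := contrP d.
have := inj (fill1 (Tagged (fun j => arrow (lab d j)) x))
  (fill1 (Tagged (fun j => arrow (lab d j)) y)).
rewrite !expand_fill1 eq_uv => /(_ erefl j); rewrite /fill1 /= dfwith_in.
have [eij|nij] := eqVneq i j; last by rewrite dfwith_out // => /single_neq0.
by case: _ / eij x {eq_uv} => x; rewrite dfwith_in => /single_inj->.
Qed.

(** * Trees of dissections with two arrows *)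

Section Pair.
Variables (P : polygon R) (d : dissection P).

(** If [a] were a loop, the three vertices would all be ends of [b]. *)
Lemma pair_edge (a b : arrow P) : a != b -> arrows d = [set a; b] ->
  src d a != tgt d a.
Proof.
move=> ab dab; apply/negP => /eqP loop.
have cardd : #|arrows d| = 2%N by rewrite dab cards2 ab.
have in_d c : c \in arrows d -> (c == a) || (c == b) by rewrite dab !inE.
have: [set: 'I_(#|arrows d|.+1)] \subset [set src d b; tgt d b].
  apply/subsetP => v _.
  have [|c [/in_d/orP[]/eqP-> ca cv]] := @vertex_on_edge _ d v; rewrite ?cardd //.
    by rewrite loop eqxx in ca.
  by rewrite !inE.
move/subset_leq_card; rewrite cards2.
by case: (_ != _); rewrite cardsT card_ord cardd.
Qed.

(** The two edges have two ends each and cover three vertices, so they share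
    exactly one vertex. *)
Lemma pair_path (a b : arrow P) : a != b -> arrows d = [set a; b] ->
  (src d a \in [set src d b; tgt d b]) (+) (tgt d a \in [set src d b; tgt d b]).
Proof.
move=> ab dab; set B := [set src d b; tgt d b].
have cardd : #|arrows d| = 2%N by rewrite dab cards2 ab.
have in_d c : c \in arrows d -> (c == a) || (c == b) by rewrite dab !inE.
pose A := [set src d a; tgt d a].
have cA : #|A| = 2%N by rewrite cards2 (pair_edge ab dab).
have cB : #|B| = 2%N by rewrite cards2 (@pair_edge b a) // 1?eq_sym // dab setUC.
have AB : A :|: B = setT.
  apply/setP => v; rewrite in_setT.
  have [|c [/in_d/orP[]/eqP-> _ cv]] := @vertex_on_edge _ d v; rewrite ?cardd //.
    by rewrite 4!inE cv.
  by rewrite inE orbC 3!inE cv.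
have cU : #|A :|: B| = 3%N by rewrite AB cardsT card_ord cardd.
have := cardsUI A B; rewrite cU cA cB.
have [sB|sB] := boolP (src d a \in B); have [tB|tB] := boolP (tgt d a \in B) => //=.
  have /setIidPl-> : A \subset B by rewrite subUset !sub1set sB.
  by rewrite cA.
have -> : A :&: B = set0.
  apply/eqP; rewrite -subset0; apply/subsetP => v /setIP[/set2P[]->].
    by rewrite (negPf sB).
  by rewrite (negPf tB).
by rewrite cards0.
Qed.

End Pair.

(** * Cancellation in the square of the boundary *)

Variables (E : algType rat) (g : polygon R -> E).
Hypothesis g_anticomm : forall P Q, g P * g Q = - (g Q * g P).

Definition single_sgn P (a : arrow P) : rat := dt_sgn phi (single a).

Definition boundary P : E :=
  \sum_(a : arrow P) single_sgn a *: (g (src_lab a) * g (tgt_lab a)).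

Lemma boundaryE P :
  \sum_(d : dissection P | #|arrows d| == 1%N)
     dt_sgn phi d *: (g (source_label P (dt_tree phi d)) *
                      g (target_label P (dt_tree phi d))) = boundary P.
Proof.
rewrite (eq_bigl (mem (@single P @: setT))) => [|d]; last first.
  apply/eqP/imsetP => [/card1_single[a ->]|[a _ ->]]; first by exists a.
  by rewrite cards1.
rewrite big_imset /=; last by move=> a b _ _; apply: single_inj.
apply: eq_big => [a|a _]; first by rewrite inE.
by have [-> ->] := single_end_labels a P.
Qed.

(** The contribution to the square of the boundary of cutting first along [a],
    then along an arrow of one of the two pieces. In the first case the source
    piece is cut, in the second one the target piece, with the sign that the
    Leibniz rule gives to the second factor. *)
Definition summand P (a : arrow P) (u : vertex_arrow (single a)) : E :=
  (single_sgn a * single_sgn (tagged u)) *: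
  (if tag u == src (single a) a
   then g (src_lab (tagged u)) * g (tgt_lab (tagged u)) * g (tgt_lab a)
   else - (g (src_lab a) * g (src_lab (tagged u)) * g (tgt_lab (tagged u)))).

(** The value of [summand] for the pair of arrows [a], [b], read off the tree of
    the dissection [{a, b}]. *)
Definition pair_value P (d : dissection P) (a b : arrow P) : E :=
  dt_sgn phi d *:
  (if src d a \in [set src d b; tgt d b]
   then g (lab d (src d b)) * g (lab d (tgt d b)) * g (lab d (tgt d a))
   else - (g (lab d (src d a)) * g (lab d (src d b)) * g (lab d (tgt d b)))).

(** The subtree [S] whose only edge is [b] contracts to one end of [a]: the source
    if [S] contains the source of [a] in the tree of [d], and the target
    otherwise. The polygon [Q] at that end has an arrow [x] contracting to [b],
    the tree of [x] is [S], and the sign of [d] is the product of those of [x]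
    and [a]. *)
Lemma summand_pair P (d : dissection P) (a b : arrow P) :
  a != b -> arrows d = [set a; b] ->
  exists2 u : vertex_arrow (single a), contr u = b & summand u = pair_value d a b.
Proof.
move=> ab dab; pose S := [set src d b; tgt d b].
have := pair_path ab dab; rewrite -/S => aS.
have in_d c : (c \in arrows d) = (c == a) || (c == b) by rewrite dab !inE.
have innerS : @inner_arrows _ K P d S = [set b].
  apply/setP => c; rewrite !inE; have [->|cb] := eqVneq c b.
    by rewrite in_d !eqxx !orbT.
  apply/negP => /andP[]; rewrite in_d (negPf cb) orbF => /eqP->.
  by rewrite -!in_set2 => /andP[sS tS]; move: aS; rewrite /S sS tS.
have adjb : @ac_adj _ K P d [set b] (src d b) (tgt d b).
  by apply/existsP; exists b; rewrite !inE !eqxx.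
have adjbC : @ac_adj _ K P d [set b] (tgt d b) (src d b).
  by apply/existsP; exists b; rewrite !inE !eqxx orbT.
have treeS : @is_subtree _ K P d S.
  split; first by apply/set0Pn; exists (src d b); rewrite !inE eqxx.
  by move=> u v /set2P[]-> /set2P[]->; rewrite innerS ?connect0 //; apply: connect1.
have [|j [dQ [contrQ realized replaced sgnd]]] := @subtreeP P d (single a) S treeS.
  rewrite innerS dab; apply/setP => c; rewrite !inE.
  by have [->|_] := eqVneq c b; [rewrite eq_sym (negPf ab)|rewrite orbF].
have [f [f_inj fS f_lab f_edge]] := realized.
have [p [pj _ p_lab p_edge]] := replaced.
(* dQ has one arrow, because its tree has the two vertices of S. *)
have [x def_dQ] : exists x, dQ = single x.
  apply: card1_single; apply: succn_inj; rewrite -[_.+1]card_ord -(card_imset _ f_inj) fS.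
  by rewrite cards2 (@pair_edge _ _ b a) // 1?eq_sym // dab setUC.
move: f f_inj fS f_lab f_edge contrQ sgnd {realized}; rewrite {dQ}def_dQ.
move=> f f_inj fS f_lab f_edge contrQ sgnd.
have contrx : ac_contr x = b.
  by apply/set1P; rewrite -innerS -contrQ imset_f // inE.
exists (existT (fun j => arrow (lab (single a) j)) j x : vertex_arrow (single a)) => //.
have [fs ft] := f_edge x (set11 x); have [ps pt] := p_edge a (set11 a).
rewrite /summand /pair_value /= sgnd mulrC; congr (_ *: _).
rewrite /src_lab /tgt_lab -!f_lab -fs -ft contrx ps pt [j == _]eq_sym pj.
rewrite -/S; move: aS; have [sS|sS] := boolP (src d a \in S) => /= tS.
  by rewrite p_lab // in_setC.
by rewrite p_lab // in_setC.
Qed.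

(** The four cases of the proof are the four possible orientations of the path
    formed by [a] and [b]. *)
Lemma pair_value_anti P (d : dissection P) (a b : arrow P) :
  a != b -> arrows d = [set a; b] -> pair_value d a b + pair_value d b a = 0.
Proof.
move=> ab dab; have dba : arrows d = [set b; a] by rewrite dab setUC.
have ba : b != a by rewrite eq_sym.
have := pair_path ab dab; have := pair_path ba dba.
have := pair_edge ab dab; have := pair_edge ba dba.
rewrite /pair_value -scalerDr !in_set2.
move: (src d a) (tgt d a) (src d b) (tgt d b) => sa ta sb tb sbtb sata pb pa.
rewrite [X in _ *: X](_ : _ = 0) ?scaler0 //; move: pb pa.
have gC3 Q1 Q2 Q3 : g Q1 * g Q2 * g Q3 = - (g Q1 * g Q3 * g Q2).
  by rewrite -!mulrA (g_anticomm Q2) mulrN.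
rewrite [tb == sa]eq_sym [tb == ta]eq_sym [sb == sa]eq_sym [sb == ta]eq_sym.
have [e1|n1] := eqVneq sa sb; have [e2|n2] := eqVneq sa tb;
  have [e3|n3] := eqVneq ta sb; have [e4|n4] := eqVneq ta tb => //= _ _.
- by rewrite e1 gC3 addNr.
- by rewrite -e2 subrr.
- by rewrite e3 addNr.
- by rewrite e4 (g_anticomm (lab d sb)) mulNr opprK addNr.
Qed.

(** The sum has at most one term; writing it as a sum avoids choosing the
    preimage of [b] and gives 0 when there is none. *)
Definition inner_sum P (a b : arrow P) : E :=
  \sum_(u : vertex_arrow (single a) | contr u == b) summand u.

Lemma inner_sum_pair P (d : dissection P) (a b : arrow P) :
  a != b -> arrows d = [set a; b] -> inner_sum a b = pair_value d a b.
Proof.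
move=> ab dab; have [u ub <-] := summand_pair ab dab; rewrite /inner_sum.
by rewrite (big_pred1 u) // => v /=; rewrite -ub (inj_eq (@contr_inj _ _)).
Qed.

Lemma inner_sum_eq0 P (a b : arrow P) :
  ~~ ((a != b) && is_dissection [set a; b]) -> inner_sum a b = 0.
Proof.
move=> nab; rewrite /inner_sum big_pred0 // => u; apply: contraNF nab => /eqP <-.
have := contr_notin u; rewrite inE eq_sym => ->.
by have := contr_dissection u; rewrite setUC.
Qed.

Lemma inner_sum_anti P (a b : arrow P) : inner_sum a b + inner_sum b a = 0.
Proof.
have [/andP[ab dab]|nab] := boolP ((a != b) && is_dissection [set a; b]).
  pose d : dissection P := exist (fun d => is_true (is_dissection d)) _ dab.
  rewrite (@inner_sum_pair _ d a b) // (@inner_sum_pair _ d b a) 1?eq_sym //.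
    exact: pair_value_anti.
  exact: setUC.
by rewrite !inner_sum_eq0 ?addr0 // eq_sym setUC.
Qed.

Lemma sum_summand P (a : arrow P) :
  \sum_(u : vertex_arrow (single a)) summand u =
  single_sgn a *: (boundary (src_lab a) * g (tgt_lab a)
                 - g (src_lab a) * boundary (tgt_lab a)).
Proof.
pose F j x :=
  summand (existT (fun j => arrow (lab (single a) j)) j x : vertex_arrow (single a)).
rewrite (eq_bigr (fun u => F (tag u) (tagged u))) => [|[j x] _ //].
rewrite -(sig_big_dep (fun j => true) (fun j x => true) F) /=.
rewrite (bigD1 (src (single a) a)) //= (bigD1 (tgt (single a) a)) /=; last first.
  by rewrite eq_sym single_src_neq_tgt.
rewrite [X in _ + (_ + X)]big_pred0 ?addr0 => [|j]; last first.
  by have /orP[/eqP->|/eqP->] := single_vertex j; rewrite eqxx ?andbF.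
rewrite /F /summand /= eqxx eq_sym (negPf (single_src_neq_tgt a)).
rewrite scalerBr /boundary mulr_suml mulr_sumr !scaler_sumr -sumrN.
congr (_ + _); apply: eq_bigr => x _.
  by rewrite -scalerAl scalerA.
by rewrite -scalerAr scalerA scalerN mulrA.
Qed.

Variable D : E -> E.
Hypothesis D_lin : linear D.
Hypothesis D_genM : forall P y, D (g P * y) = D (g P) * y - g P * D y.
Hypothesis D_gen : forall P, D (g P) = boundary P.

HB.instance Definition _ := GRing.isLinear.Build rat E E *:%R D D_lin.

(** Antisymmetry of [inner_sum] shows that the square is equal to its opposite,
    and 2 is invertible. *)
Lemma boundary_square P : D (boundary P) = 0.
Proof.
have -> : D (boundary P) = \sum_(a : arrow P) \sum_(b : arrow P) inner_sum a b.
  rewrite linear_sum; apply: eq_bigr => a _.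
  rewrite linearZ /= D_genM !D_gen -sum_summand.
  by rewrite (partition_big (@contr _ _) xpredT).
pose S := \sum_(a : arrow P) \sum_(b : arrow P) inner_sum a b.
rewrite -/S; have SS : S + S = 0.
  rewrite {2}/S exchange_big -big_split big1 // => a _.
  by rewrite -big_split big1 // => b _; apply: inner_sum_anti.
apply/eqP; have : 2%:R *: S == 0 by rewrite scaler_nat mulr2n SS.
by rewrite scaler_eq0 orFb.
Qed.

End Boundary.

(** * The differential on polygons *)

Fact ext_proj_additive (X : choiceType) : {morph @ext_proj X : a b / a - b}.
Proof. by move=> a b; rewrite /ext_proj raddfB. Qed.

HB.instance Definition _ (X : choiceType) :=
  GRing.isZmodMorphism.Build {malg rat[{fmonom X}]} (extalg X) (@ext_proj X)
    (@ext_proj_additive X).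
HB.instance Definition _ (X : choiceType) :=
  GRing.isScalable.Build rat {malg rat[{fmonom X}]} (extalg X) *:%R (@ext_proj X)
    (@ext_projZ X).

Theorem theorem35 (R : choiceType) (phi : dual_tree_gen R)
    (hphi : dissection_compatible phi) :
  exists D : extalg (polygon R) -> extalg (polygon R),
    [/\ degree1_derivation D,
        (forall P : polygon R, D (ext_gen P) = dt_boundary phi P),
        (forall D' : extalg (polygon R) -> extalg (polygon R),
           degree1_derivation D' ->
           (forall P : polygon R, D' (ext_gen P) = dt_boundary phi P) ->
           forall x, D' x = D x)
      & forall x, D (D x) = 0].
Proof.
have [_ [K [edgesP contrP _ subtreeP]]] := hphi.
pose X := polygon R; pose E : algType rat := extalg X.
pose proj : {linear {malg rat[{fmonom X}]} -> E} := @ext_proj X.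
have proj1 : proj 1 = 1 by [].
have projM (a b : {malg rat[{fmonom X}]}) : proj (a * b) = proj a * proj b.
  exact: ext_projM.
have liftK : cancel (@ext_lift X) proj := @ext_liftK X.
have proj_ker (a b : {malg rat[{fmonom X}]}) : proj a = proj b <-> a - b \in @ext_ideal X.
  by split=> /ext_projP.
have gen_boundary P : dt_boundary phi P = boundary phi K (gen proj) P.
  exact: (boundaryE edgesP (gen proj)).
have hom2 P : homog proj 2 (dt_boundary phi P).
  rewrite gen_boundary; apply: big_rec => [|a x _ hx]; first exact: homog0.
  apply: homog_lin hx; exact: (homogM projM (homog_gen proj _) (homog_gen proj _)).
have [D derD D_gen] := derivation_exists proj1 projM liftK proj_ker hom2.
exists D; split.
- exact: derD.
- exact: D_gen.
- move=> D' derD' D'_gen; apply: (derivation_ext proj1 projM liftK derD derD') => P.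
  by rewrite D_gen; apply: D'_gen.
apply: (derivation_square proj1 projM liftK derD) => P.
rewrite D_gen gen_boundary.
apply: (boundary_square edgesP contrP subtreeP) => [Q Q'||Q y|Q].
- exact: (gen_anticomm projM proj_ker).
- exact: (derivation_linear derD).
- exact: (derivation_genM derD).
by rewrite D_gen; apply: gen_boundary.
Qed.
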